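(* Let $Y\in\mathbb{H}^{n\times n}$. Then $r^\vee(Y)\le1$ if and only if there exists a selfadjoint $X\in\mathbb{H}^{n\times n}$ with $\operatorname{Tr}X=1$ such that the matrix $$Z=\begin{bmatrix}X&Y\\ Y^*&X\end{bmatrix}\in\mathbb{H}^{2n\times2n}$$ is (selfadjoint) positive semidefinite.
   Context: $\mathbb{H}$ is the skew-field of quaternions, with $|q|$ the quaternion modulus and $\Re q$ the real part; $A^*$ is the conjugate transpose of a quaternionic matrix and $\operatorname{Tr}$ the sum of diagonal entries (real for selfadjoint matrices). A selfadjoint quaternionic matrix $Z$ (i.e. $Z^*=Z$) of order $N$ is positive semidefinite if $\mathbf{x}^*Z\mathbf{x}\ge0$ for all $\mathbf{x}\in\mathbb{H}^N$. For $A\in\mathbb{H}^{n\times n}$ the numerical radius is $r(A)=\max\{|\mathbf{x}^*A\mathbf{x}|:\mathbf{x}\in\mathbb{H}^n,\ \mathbf{x}^*\mathbf{x}=1\}$, and its dual norm is $r^\vee(C)=\max\{\Re\operatorname{Tr}(A^*C):A\in\mathbb{H}^{n\times n},\ r(A)\le1\}$ for $C\in\mathbb{H}^{n\times n}$. *)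

(* Defs.v *)
From HB Require Import structures.
From mathcomp Require Import all_boot all_order all_algebra.
From mathcomp Require Import boolp classical_sets reals.
From mathcomp Require Import ring lra.

Set Implicit Arguments.
Unset Strict Implicit.
Unset Printing Implicit Defensive.

Import Order.TTheory GRing.Theory Num.Theory.
Local Open Scope ring_scope.
Local Open Scope classical_set_scope.

(* [Quat a b c d] is the quaternion a + b i + c j + d k. *)
Record quaternion (R : Type) := Quat { qr : R; qi : R; qj : R; qk : R }.

Section QuaternionRing.
Variable R : realType.
Local Notation H := (quaternion R).

Definition quat_to_prod (q : H) : R * R * R * R := (qr q, qi q, qj q, qk q).
Definition prod_to_quat (p : R * R * R * R) : H :=
  let: (a, b, c, d) := p in Quat a b c d.

Lemma quat_to_prodK : cancel quat_to_prod prod_to_quat.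
Proof. by case. Qed.

HB.instance Definition _ := Choice.copy H (can_type quat_to_prodK).

Definition qzero : H := Quat 0 0 0 0.
Definition qone : H := Quat 1 0 0 0.
Definition qopp (p : H) : H := Quat (- qr p) (- qi p) (- qj p) (- qk p).
Definition qadd (p q : H) : H :=
  Quat (qr p + qr q) (qi p + qi q) (qj p + qj q) (qk p + qk q).
(* i^2 = j^2 = k^2 = i j k = -1 *)
Definition qmul (p q : H) : H :=
  Quat (qr p * qr q - qi p * qi q - qj p * qj q - qk p * qk q)
       (qr p * qi q + qi p * qr q + qj p * qk q - qk p * qj q)
       (qr p * qj q - qi p * qk q + qj p * qr q + qk p * qi q)
       (qr p * qk q + qi p * qj q - qj p * qi q + qk p * qr q).

Lemma qaddA : associative qadd.
Proof. by move=> [????] [????] [????]; congr Quat => /=; ring. Qed.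

Lemma qaddC : commutative qadd.
Proof. by move=> [????] [????]; congr Quat => /=; ring. Qed.

Lemma qadd0 : left_id qzero qadd.
Proof. by move=> [????]; congr Quat => /=; ring. Qed.

Lemma qaddN : left_inverse qzero qopp qadd.
Proof. by move=> [????]; congr Quat => /=; ring. Qed.

HB.instance Definition _ := GRing.isZmodule.Build H qaddA qaddC qadd0 qaddN.

Lemma qmulA : associative qmul.
Proof. by move=> [????] [????] [????]; congr Quat => /=; ring. Qed.

Lemma qmul1q : left_id qone qmul.
Proof. by move=> [????]; congr Quat => /=; ring. Qed.

Lemma qmulq1 : right_id qone qmul.
Proof. by move=> [????]; congr Quat => /=; ring. Qed.

Lemma qmulDl : left_distributive qmul qadd.
Proof. by move=> [????] [????] [????]; congr Quat => /=; ring. Qed.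

Lemma qmulDr : right_distributive qmul qadd.
Proof. by move=> [????] [????] [????]; congr Quat => /=; ring. Qed.

Lemma qone_neq0 : qone != 0 :> H.
Proof. by apply/eqP => -[] /eqP; rewrite oner_eq0. Qed.

HB.instance Definition _ :=
  GRing.Zmodule_isNzRing.Build H qmulA qmul1q qmulq1 qmulDl qmulDr qone_neq0.

Definition qconj (q : H) : H := Quat (qr q) (- qi q) (- qj q) (- qk q).

Definition qmod (q : H) : R :=
  Num.sqrt (qr q ^+ 2 + qi q ^+ 2 + qj q ^+ 2 + qk q ^+ 2).

Definition qreal (a : R) : H := Quat a 0 0 0.

(* A quaternionic inequality 0 <= q includes the assertion that q is real. *)
Definition qnonneg (q : H) : Prop := exists2 a : R, 0 <= a & q = qreal a.

End QuaternionRing.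

Section QuaternionMatrices.
Variable R : realType.
Local Notation H := (quaternion R).

Definition conjtr m n (A : 'M[H]_(m, n)) : 'M[H]_(n, m) :=
  map_mx (@qconj R) A^T.

Definition selfadjoint n (A : 'M[H]_n) : Prop := conjtr A = A.

Definition qform n (A : 'M[H]_n) (x : 'cV[H]_n) : H :=
  (conjtr x *m A *m x) 0 0.

Definition psd n (Z : 'M[H]_n) : Prop :=
  selfadjoint Z /\ forall x : 'cV[H]_n, qnonneg (qform Z x).

(* For n > 0 both sets below are nonempty and compact, so that the suprema
   are maxima. *)
Definition numerical_radius n (A : 'M[H]_n) : R :=
  sup [set qmod (qform A x) | x in
        [set x : 'cV[H]_n | conjtr x *m x = 1%:M]].

Definition dual_numerical_radius n (C : 'M[H]_n) : R :=
  sup [set qr (\tr (conjtr A *m C)) | A in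
        [set A : 'M[H]_n | numerical_radius A <= 1]].

End QuaternionMatrices.

(* Main.v *)
Require Import Defs.
From HB Require Import structures.
From mathcomp Require Import all_boot all_order all_algebra.
From mathcomp Require Import boolp classical_sets reals.
From mathcomp Require Import topology normedtype derive.
From mathcomp Require Import ring lra zify.

(** Call a matrix [Y] a feasible corner when it completes some selfadjoint [X]
    of trace 1 to a positive semidefinite block matrix [X Y; Y^* X]. The claim
    is that the feasible corners are the unit ball of the dual norm. Everything
    is phrased with the real inner product [frob A B = Re Tr (A^* B)].

    Feasible corners lie in the dual ball ([numrad_frob_le]). After an
    arbitrarily small perturbation the block matrix is positive definite, so
    that with [P = Y^* X^-1] one has [P X = Y^*] and [X - P X P^* = G G^*].
    Thus [X] is the stationary covariance of the chain [x' = P x + noise] and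
    [Y] is its one-step covariance. If the numerical radius of [A] is at most
    1, then any vectors [q_0, .., q_m] satisfy
    [\sum_(j < m) Re (q_j^* A q_(j+1)) <= \sum_(j <= m) |q_j|^2]
    ([numrad_chain_vec]): evaluate the form of [A] at [\sum_j q_j w^j] for
    unit quaternions [w] and average over [w]. Summed over a realisation of the
    stationary chain with [M] steps this reads
    [M * frob Y A <= (M + 1) * Re Tr X], and [M] tends to infinity
    ([numrad_stein]). The average needs only that every unit quaternion is a
    square ([trig_poly_mean_ge0]), and the factorisations only a Cholesky
    decomposition over the quaternions ([cholesky]).

    Conversely ([dual_certificate]), the feasible block matrices form a compact
    convex set. If [Y] is not a feasible corner, let [P] be the nearest one and
    [A = Y - P]; then [frob A] is at most [c = frob A P] on all feasible
    corners and exceeds [c] at [Y]. The matrices [x d x^*] with [x] a unit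
    vector and [d] a unit quaternion are feasible corners, with [X = x x^*],
    and for a suitable [d] the functional [frob A] takes the value [|x^* A x|]
    there. So the numerical radius of [A] is at most [c], and a multiple of [A]
    shows that the dual norm of [Y] exceeds 1.

    The suprema are taken in the reals, so both directions also need the sets
    involved to be bounded: [qform_bounded] for the numerical radius, and for
    the dual norm [numrad_frob_le] applied to [X = 1 + Y Y^*] ([gram_psd]). *)

Set Implicit Arguments.
Unset Strict Implicit.
Unset Printing Implicit Defensive.

Import Order.TTheory GRing.Theory Num.Theory.
Import numFieldNormedType.Exports.
Local Open Scope ring_scope.

(** * Quaternions and averages over unit quaternions *)

Section Quaternions.
Variable R : realType.
Local Notation H := (quaternion R).
Implicit Types (p q : H) (a : R).

Lemma qr_is_zmod_morphism : zmod_morphism (@qr R : H -> R).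
Proof. by []. Qed.
HB.instance Definition _ :=
  GRing.isZmodMorphism.Build H R (@qr R) qr_is_zmod_morphism.

Lemma qconj_is_zmod_morphism : zmod_morphism (@qconj R : H -> H).
Proof. by move=> [????] [????]; congr Quat => /=; ring. Qed.
HB.instance Definition _ :=
  GRing.isZmodMorphism.Build H H (@qconj R) qconj_is_zmod_morphism.

Lemma qreal_is_zmod_morphism : zmod_morphism (@qreal R : R -> H).
Proof. by move=> a b; congr Quat => /=; ring. Qed.
HB.instance Definition _ :=
  GRing.isZmodMorphism.Build R H (@qreal R) qreal_is_zmod_morphism.

Lemma qreal_is_monoid_morphism : monoid_morphism (@qreal R : R -> H).
Proof. by split=> // a b; congr Quat => /=; ring. Qed.
HB.instance Definition _ :=
  GRing.isMonoidMorphism.Build R H (@qreal R) qreal_is_monoid_morphism.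

Lemma qconjK : involutive (@qconj R).
Proof. by move=> [????]; congr Quat => /=; ring. Qed.

Lemma qconjM p q : qconj (p * q) = qconj q * qconj p.
Proof. by case: p => ????; case: q => ????; congr Quat => /=; ring. Qed.

Lemma qconj1 : qconj 1 = 1 :> H.
Proof. by congr Quat => /=; ring. Qed.

Lemma qconj_real a : qconj (qreal a) = qreal a.
Proof. by congr Quat => /=; ring. Qed.

Lemma qr_conj q : qr (qconj q) = qr q. Proof. by []. Qed.

Lemma qrD p q : qr (p + q) = qr p + qr q. Proof. by []. Qed.

Lemma qrC p q : qr (p * q) = qr (q * p).
Proof. by case: p => ????; case: q => ???? /=; ring. Qed.

Lemma qr_realM a q : qr (qreal a * q) = a * qr q.
Proof. by case: q => ???? /=; ring. Qed.

Lemma qreal_comm a q : qreal a * q = q * qreal a.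
Proof. by case: q => ????; congr Quat => /=; ring. Qed.

Lemma qreal_scale_sqr a q :
  (qreal a * q) * (qreal a * q) = qreal (a * a) * (q * q).
Proof. by case: q => ????; congr Quat => /=; ring. Qed.

Lemma qconj_fix q : qconj q = q -> q = qreal (qr q).
Proof. by case: q => a b c d [] *; congr Quat => /=; lra. Qed.

Definition qnormsq q : R := qr (qconj q * q).

Lemma qnormsqE q : qnormsq q = qr q ^+ 2 + qi q ^+ 2 + qj q ^+ 2 + qk q ^+ 2.
Proof. by case: q => ????; rewrite /qnormsq /=; ring. Qed.

Lemma qconj_mul q : qconj q * q = qreal (qnormsq q).
Proof. by case: q => ????; rewrite /qnormsq; congr Quat => /=; ring. Qed.

Lemma qmul_conj q : q * qconj q = qreal (qnormsq q).
Proof. by case: q => ????; rewrite /qnormsq; congr Quat => /=; ring. Qed.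

Lemma qnormsq_ge0 q : 0 <= qnormsq q.
Proof. by rewrite qnormsqE !addr_ge0 ?sqr_ge0. Qed.

Lemma qnormsq_eq0 q : (qnormsq q == 0) = (q == 0).
Proof.
apply/eqP/eqP => [|->]; last by rewrite /qnormsq mulr0.
rewrite qnormsqE; case: q => a b c d /= h.
have := sqr_ge0 a; have := sqr_ge0 b; have := sqr_ge0 c; have := sqr_ge0 d.
move=> *; congr Quat; apply/eqP; rewrite -sqrf_eq0; apply/eqP; lra.
Qed.

Lemma qnormsqM p q : qnormsq (p * q) = qnormsq p * qnormsq q.
Proof. by case: p => ????; case: q => ????; rewrite /qnormsq /=; ring. Qed.

Lemma qnormsq_real a : qnormsq (qreal a) = a ^+ 2.
Proof. by rewrite qnormsqE /=; ring. Qed.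

Lemma qnormsq_conj q : qnormsq (qconj q) = qnormsq q.
Proof. by rewrite !qnormsqE /= !sqrrN. Qed.

Lemma qr_conj_mul_le p q : qr (qconj p * q) <= (qnormsq p + qnormsq q) / 2.
Proof.
have := qnormsq_ge0 (p - q); case: p => ????; case: q => ????.
by rewrite !qnormsqE /=; lra.
Qed.

Lemma qmod_ge0 q : 0 <= qmod q. Proof. exact: sqrtr_ge0. Qed.

Lemma qmod_sqr q : qmod q ^+ 2 = qnormsq q.
Proof. by rewrite /qmod -qnormsqE sqr_sqrtr ?qnormsq_ge0. Qed.

Lemma qmod_conj q : qmod (qconj q) = qmod q.
Proof. by rewrite /qmod /= !sqrrN. Qed.

Lemma qmodM p q : qmod (p * q) = qmod p * qmod q.
Proof. by rewrite /qmod -!qnormsqE qnormsqM sqrtrM ?qnormsq_ge0. Qed.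

Lemma qmod_real a : 0 <= a -> qmod (qreal a) = a.
Proof. by move=> a0; rewrite /qmod -qnormsqE qnormsq_real sqrtr_sqr ger0_norm. Qed.

Lemma qr_le_qmod q : qr q <= qmod q.
Proof.
apply: le_trans (ler_norm _) _; rewrite -sqrtr_sqr ler_wsqrtr //.
by rewrite -!addrA lerDl !addr_ge0 ?sqr_ge0.
Qed.

Lemma qr_mul_unit_le p q : qnormsq q = 1 -> qr (p * q) <= qmod p.
Proof.
move=> q1; apply: le_trans (qr_le_qmod _) _.
by rewrite /qmod -!qnormsqE qnormsqM q1 mulr1.
Qed.

(** The witness is the phase that rotates a quaternion onto the nonnegative reals. *)
Lemma qmod_attained q : exists2 d : H, qnormsq d = 1 & qr (q * d) = qmod q.
Proof.
have [q0|q0] := eqVneq (qmod q) 0.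
  exists 1; first by rewrite qnormsqE /=; ring.
  have : q = 0 by apply/eqP; rewrite -qnormsq_eq0 -qmod_sqr q0 expr0n.
  by rewrite q0 => ->; rewrite mul0r.
exists (qreal (qmod q)^-1 * qconj q).
  by rewrite qnormsqM qnormsq_real qnormsq_conj -qmod_sqr; field.
by rewrite qrC -mulrA qconj_mul qr_realM /= -qmod_sqr; field.
Qed.

Lemma qnormsq1_conj w : qnormsq w = 1 -> w * qconj w = 1.
Proof. by rewrite qmul_conj => ->. Qed.

(** The basis 1, i, j, k, orthonormal for [Re (conj p * q)]. *)
Definition basic_unit (k : 'I_4) : H :=
  tnth [tuple Quat 1 0 0 0; Quat 0 1 0 0; Quat 0 0 1 0; Quat 0 0 0 1] k.

Lemma basic_unit_norm k : qnormsq (basic_unit k) = 1.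
Proof.
rewrite qnormsqE /basic_unit (tnth_nth 0).
by case: k => [[|[|[|[|//]]]] ?] /=; ring.
Qed.

Lemma quat_expand q :
  q = \sum_k qreal (qr (qconj (basic_unit k) * q)) * basic_unit k.
Proof.
rewrite !big_ord_recr big_ord0 /basic_unit !(tnth_nth 0) /=.
by case: q => a b c d; congr Quat => /=; ring.
Qed.

(** Off the point -1 the root is the normalised midpoint of 1 and [w], since
    [(1 + w)^2 = w * |1 + w|^2]; at -1 any imaginary unit will do. *)
Lemma qunit_sqrt w : qnormsq w = 1 -> exists2 s : H, qnormsq s = 1 & s * s = w.
Proof.
case: w => a b c d; rewrite qnormsqE /= => w1.
have [a1|a1] := eqVneq a (-1).
  have /eqP : b ^+ 2 + c ^+ 2 + d ^+ 2 = 0 by move: w1; rewrite a1 sqrrN; lra.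
  rewrite !paddr_eq0 ?addr_ge0 ?sqr_ge0 // !sqrf_eq0.
  move=> /andP[/andP[/eqP b0 /eqP c0] /eqP d0].
  exists (Quat 0 1 0 0); first by rewrite qnormsqE /=; ring.
  by congr Quat => /=; rewrite ?a1 ?b0 ?c0 ?d0; ring.
have a_gt : 0 < 2 * (1 + a).
  have : a ^+ 2 <= 1.
    by rewrite -w1 -!addrA lerDl !addr_ge0 ?sqr_ge0.
  move: a1; rewrite neq_lt => /orP[]; nra.
pose t := Num.sqrt (2 * (1 + a)).
have t2 : t ^+ 2 = 2 * (1 + a) by rewrite sqr_sqrtr // ltW.
have t0 : t != 0 by rewrite gt_eqF // sqrtr_gt0.
exists (qreal t^-1 * (Quat (1 + a) b c d)).
  rewrite qnormsqM qnormsq_real qnormsqE /=.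
  transitivity (t ^- 2 * (2 * (1 + a))); last by rewrite t2 mulVf // gt_eqF.
  by rewrite exprVn; congr (_ * _); lra.
rewrite qreal_scale_sqr.
have -> : t^-1 * t^-1 = (2 * (1 + a))^-1 by rewrite -t2; field.
have e0 : 1 + a != 0 by apply/eqP => e; rewrite e mulr0 ltxx in a_gt.
have hb : b ^+ 2 + c ^+ 2 + d ^+ 2 = 1 - a ^+ 2 by lra.
congr Quat => /=; rewrite ?mulr0 ?subr0 ?addr0 ?add0r; try by field.
transitivity (((1 + a) ^+ 2 - (b ^+ 2 + c ^+ 2 + d ^+ 2)) * (2 * (1 + a))^-1).
  by ring.
by rewrite hb; field.
Qed.

(* From here on products of quaternions are handled algebraically;
   simplification must not expand them into coordinates. *)
#[global] Arguments qr {R} q : simpl never.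
#[global] Arguments qi {R} q : simpl never.
#[global] Arguments qj {R} q : simpl never.
#[global] Arguments qk {R} q : simpl never.

Lemma qnormsq1 : qnormsq (1 : H) = 1.
Proof. by rewrite -[1](rmorph1 (@qreal R)) qnormsq_real expr1n. Qed.

Lemma qnormsqN q : qnormsq (- q) = qnormsq q.
Proof. by rewrite /qnormsq raddfN mulrNN. Qed.

(** Averaging over [w] and [- w] kills the odd terms and leaves a polynomial
    in [w ^+ 2]; since every unit quaternion is a square, the exponents can
    be halved until only the constant terms survive. Rounding the halves down
    is harmless: when [a] and [b] are both odd, the factors [w] and [conj w]
    left over multiply to 1. *)
Lemma trig_poly_mean_ge0 (M : nat) (I : finType) (P : pred I) (c : I -> H)
    (a b : I -> nat) :
    (forall i, P i -> (a i <= M)%N && (b i <= M)%N) ->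
    (forall w, qnormsq w = 1 ->
      0 <= \sum_(i | P i) qr (c i * (w ^+ a i * qconj w ^+ b i))) ->
  0 <= \sum_(i | P i && (a i == b i)) qr (c i).
Proof.
(* The halved exponents need strong induction on their bound. *)
elim: M {-2}M (leqnn M) P a b => [|k IHk] M leMk P a b abM pos.
  have ab0 i : P i -> a i = 0%N /\ b i = 0%N.
    by move/abM/andP => [aM bM]; split; apply/eqP; rewrite -leqn0 (leq_trans _ leMk).
  move: (pos _ qnormsq1); congr (0 <= _); apply: eq_big => [i|i /ab0[-> ->]].
    by case Pi : (P i) => //=; have [-> ->] := ab0 _ Pi.
  by rewrite !expr0 !mulr1.
case: M leMk abM => [|M] leMk abM; first by apply: (IHk 0%N).
pose P' i := P i && (odd (a i) == odd (b i)).
have eqP' : (fun i => P i && (a i == b i)) =1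
    (fun i => P' i && ((a i)./2 == (b i)./2)).
  move=> i; rewrite /P' -andbA; congr andb; apply/idP/idP => [/eqP->|].
    by rewrite !eqxx.
  by move=> /andP[/eqP o /eqP h]; rewrite -(odd_double_half (a i)) o h odd_double_half.
rewrite (eq_bigl _ _ eqP'); apply: (IHk M.+1./2).
- by rewrite leq_half_double; lia.
- by move=> i /andP[/abM/andP[aM bM] _]; rewrite !half_leq.
move=> v /qunit_sqrt[w w1 wv].
have := addr_ge0 (pos _ w1) (pos (- w) _).
rewrite qnormsqN w1 => /(_ erefl); rewrite -big_split /=.
rewrite (bigID (fun i => odd (a i) == odd (b i))) /=.
rewrite [X in _ + X]big1 ?addr0 => [|i /andP[_ neq]]; last first.
  rewrite raddfN /= -qrD -mulrDr exprNn [(- _) ^+ b i]exprNn.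
  rewrite -signr_odd -[(-1) ^+ b i]signr_odd.
  by case: (odd (a i)) (odd (b i)) neq => [] [] //= _;
    rewrite !expr1 !expr0 !mulN1r !mul1r ?mulNr ?mulrN subrr mulr0.
rewrite [X in 0 <= X -> _](_ : _ =
  2 * \sum_(i | P' i) qr (c i * (v ^+ (a i)./2 * qconj v ^+ (b i)./2))).
  by rewrite pmulr_rge0.
rewrite mulr_sumr; apply: eq_bigr => i /andP[_ /eqP oab].
have e : (- w) ^+ a i * qconj (- w) ^+ b i = w ^+ a i * qconj w ^+ b i.
  rewrite raddfN /= exprNn [(- _) ^+ b i]exprNn -signr_odd -[(-1) ^+ b i]signr_odd -oab.
  by case: odd; rewrite !(expr1, expr0) ?mulN1r ?mul1r ?mulrNN ?mul1r.
rewrite e mulr_natl mulr2n.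
suff -> : w ^+ a i * qconj w ^+ b i = v ^+ (a i)./2 * qconj v ^+ (b i)./2 by [].
have sq u m : (u : H) ^+ m = u ^+ odd m * (u * u) ^+ m./2.
  by rewrite -expr2 -exprM mul2n -exprD odd_double_half.
have cw : w * qconj w = qconj w * w by rewrite qconj_mul qmul_conj.
rewrite -wv qconjM (sq w) (sq (qconj w)) -oab.
have cwX m k' : GRing.comm (qconj w ^+ m) ((w * w) ^+ k').
  by apply: commrX; apply: commrM; apply/commr_sym/commrX; rewrite /GRing.comm cw.
rewrite -mulrA (mulrA ((w * w) ^+ _)) -cwX !mulrA.
suff -> : w ^+ odd (a i) * qconj w ^+ odd (a i) = 1 by rewrite mul1r.
by case: odd; rewrite ?expr1 ?expr0 ?mul1r ?qnormsq1_conj.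
Qed.

End Quaternions.

(** * Conjugate transpose and the real inner product *)

Section ConjugateTranspose.
Variable R : realType.
Local Notation H := (quaternion R).

Lemma conjtr_is_zmod_morphism m n :
  zmod_morphism (@conjtr R m n : 'M[H]_(m, n) -> 'M[H]_(n, m)).
Proof. by move=> A B; apply/matrixP => i j; rewrite !mxE raddfB. Qed.
HB.instance Definition _ m n := GRing.isZmodMorphism.Build
  'M[H]_(m, n) 'M[H]_(n, m) (@conjtr R m n) (@conjtr_is_zmod_morphism m n).

Lemma conjtrK m n (A : 'M[H]_(m, n)) : conjtr (conjtr A) = A.
Proof. by apply/matrixP => i j; rewrite !mxE qconjK. Qed.

Lemma conjtrM m n p (A : 'M[H]_(m, n)) (B : 'M[H]_(n, p)) :
  conjtr (A *m B) = conjtr B *m conjtr A.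
Proof.
apply/matrixP => i j; rewrite !mxE raddf_sum; apply: eq_bigr => k _ /=.
by rewrite !mxE qconjM.
Qed.

Lemma conjtr_scalar n (q : H) : conjtr (q%:M : 'M_n) = (qconj q)%:M.
Proof. by apply/matrixP => i j; rewrite !mxE eq_sym raddfMn. Qed.

Lemma conjtr1 n : conjtr (1%:M : 'M[H]_n) = 1%:M.
Proof. by rewrite conjtr_scalar qconj1. Qed.

Lemma conjtr_col m1 m2 n (A : 'M[H]_(m1, n)) (B : 'M[H]_(m2, n)) :
  conjtr (col_mx A B) = row_mx (conjtr A) (conjtr B).
Proof. by rewrite /conjtr tr_col_mx map_row_mx. Qed.

Lemma conjtr_block m1 m2 n1 n2 (A : 'M[H]_(m1, n1)) (B : 'M[H]_(m1, n2))
    (C : 'M[H]_(m2, n1)) (D : 'M[H]_(m2, n2)) :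
  conjtr (block_mx A B C D)
  = block_mx (conjtr A) (conjtr C) (conjtr B) (conjtr D).
Proof. by rewrite /conjtr tr_block_mx map_block_mx. Qed.

(** Over the quaternions only the real part of the trace is cyclic. *)
Lemma qr_trC m n (A : 'M[H]_(m, n)) (B : 'M[H]_(n, m)) :
  qr (\tr (A *m B)) = qr (\tr (B *m A)).
Proof.
rewrite /mxtrace !raddf_sum /=.
under eq_bigr => i _ do rewrite mxE raddf_sum /=.
rewrite exchange_big /=; apply: eq_bigr => i _; rewrite mxE raddf_sum /=.
by apply: eq_bigr => j _; rewrite qrC.
Qed.

Definition frob m n (A B : 'M[H]_(m, n)) : R := qr (\tr (conjtr A *m B)).

Lemma frobE m n (A B : 'M[H]_(m, n)) :
  frob A B = \sum_j \sum_i qr (qconj (A i j) * B i j).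
Proof.
rewrite /frob /mxtrace raddf_sum /=; apply: eq_bigr => j _.
by rewrite mxE raddf_sum /=; apply: eq_bigr => i _; rewrite !mxE.
Qed.

Lemma frobC m n (A B : 'M[H]_(m, n)) : frob A B = frob B A.
Proof.
rewrite !frobE; apply: eq_bigr => j _; apply: eq_bigr => i _.
by rewrite -[LHS]qr_conj qconjM qconjK.
Qed.

Lemma frob_is_zmod_morphism m n (A : 'M[H]_(m, n)) : zmod_morphism (frob A).
Proof. by move=> B C; rewrite /frob mulmxBr !raddfB. Qed.
HB.instance Definition _ m n (A : 'M[H]_(m, n)) := GRing.isZmodMorphism.Build
  'M[H]_(m, n) R (frob A) (@frob_is_zmod_morphism m n A).

Lemma frobDr m n (A B C : 'M[H]_(m, n)) :
  frob A (B + C) = frob A B + frob A C.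
Proof. exact: raddfD. Qed.

Lemma frobDl m n (A B C : 'M[H]_(m, n)) :
  frob (B + C) A = frob B A + frob C A.
Proof. by rewrite ![frob _ A]frobC frobDr. Qed.

Lemma frobBl m n (A B C : 'M[H]_(m, n)) :
  frob (B - C) A = frob B A - frob C A.
Proof. by rewrite ![frob _ A]frobC raddfB. Qed.

Lemma frobNl m n (A B : 'M[H]_(m, n)) : frob (- B) A = - frob B A.
Proof. by rewrite ![frob _ A]frobC raddfN. Qed.

Lemma frob0l m n (A : 'M[H]_(m, n)) : frob 0 A = 0.
Proof. by rewrite frobC raddf0. Qed.

Lemma frobZr m n (a : R) (A B : 'M[H]_(m, n)) :
  frob A (qreal a *: B) = a * frob A B.
Proof.
rewrite !frobE mulr_sumr; apply: eq_bigr => j _; rewrite mulr_sumr.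
apply: eq_bigr => i _; rewrite mxE mulrA -qreal_comm -mulrA.
by rewrite qr_realM.
Qed.

Lemma frobZl m n (a : R) (A B : 'M[H]_(m, n)) :
  frob (qreal a *: A) B = a * frob A B.
Proof. by rewrite frobC frobZr frobC. Qed.

Lemma frob_sub_scale m n (U V : 'M[H]_(m, n)) (t : R) :
  frob (U - qreal t *: V) (U - qreal t *: V) =
  frob U U - 2 * t * frob U V + t ^+ 2 * frob V V.
Proof.
rewrite raddfB /= !frobBl !frobZr !frobZl.
by rewrite [frob V U]frobC; ring.
Qed.

Lemma frob_norm m n (A : 'M[H]_(m, n)) :
  frob A A = \sum_j \sum_i qnormsq (A i j).
Proof. by rewrite frobE. Qed.

Lemma frob_ge0 m n (A : 'M[H]_(m, n)) : 0 <= frob A A.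
Proof.
rewrite frob_norm; apply: sumr_ge0 => j _; apply: sumr_ge0 => i _.
exact: qnormsq_ge0.
Qed.

Lemma frob_eq0 m n (A : 'M[H]_(m, n)) : frob A A = 0 -> A = 0.
Proof.
rewrite frob_norm => /eqP; rewrite psumr_eq0; last first.
  by move=> j _; apply: sumr_ge0 => i _; exact: qnormsq_ge0.
move=> /allP h; apply/matrixP => i j; rewrite mxE; apply/eqP.
have := h j (mem_index_enum j); rewrite /= psumr_eq0; last first.
  by move=> k _; exact: qnormsq_ge0.
by move=> /allP /(_ i (mem_index_enum i)); rewrite /= qnormsq_eq0.
Qed.

Lemma frob_gt0 m n (A : 'M[H]_(m, n)) : A != 0 -> 0 < frob A A.
Proof.
move=> A0; rewrite lt_def frob_ge0 andbT; apply: contraNneq A0.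
by move=> /frob_eq0 ->.
Qed.

Lemma frob_mull m n p (M : 'M[H]_(m, n)) (A : 'M[H]_(n, p)) (B : 'M[H]_(m, p)) :
  frob (M *m A) B = frob A (conjtr M *m B).
Proof. by rewrite /frob conjtrM mulmxA. Qed.

Lemma frob_adj m n p (M : 'M[H]_(m, n)) (A : 'M[H]_(m, p)) (B : 'M[H]_(n, p)) :
  frob A (M *m B) = frob (conjtr M *m A) B.
Proof. by rewrite frob_mull conjtrK. Qed.

Lemma mulmx_real m n (A : 'M[H]_(m, n)) (a : R) :
  A *m (qreal a)%:M = qreal a *: A.
Proof.
apply/matrixP => i j; rewrite !mxE (bigD1 j) //= big1 => [|k /negPf ne].
  by rewrite addr0 mxE eqxx mulr1n qreal_comm.
by rewrite mxE ne mulr0.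
Qed.

Lemma frob_mulr m n p (M : 'M[H]_(n, p)) (A : 'M[H]_(m, n)) (B : 'M[H]_(m, p)) :
  frob (A *m M) B = frob A (B *m conjtr M).
Proof. by rewrite /frob conjtrM -mulmxA qr_trC mulmxA. Qed.

Lemma frob_conjtr m n (A B : 'M[H]_(m, n)) :
  frob (conjtr A) (conjtr B) = frob A B.
Proof. by rewrite [RHS]frobC /frob conjtrK qr_trC. Qed.

Lemma frob_col m1 m2 n (A C : 'M[H]_(m1, n)) (B D : 'M[H]_(m2, n)) :
  frob (col_mx A B) (col_mx C D) = frob A C + frob B D.
Proof. by rewrite /frob conjtr_col mul_row_col !raddfD. Qed.

Lemma frob_cols m n (A B : 'M[H]_(m, n)) :
  frob A B = \sum_j frob (col j A) (col j B).
Proof.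
rewrite frobE; apply: eq_bigr => j _; rewrite frobE big_ord1.
by apply: eq_bigr => i _; rewrite !mxE.
Qed.

Lemma qr_qform n (Z : 'M[H]_n) (x : 'cV[H]_n) :
  qr (qform Z x) = frob x (Z *m x).
Proof. by rewrite /qform /frob trace_mx11 mulmxA. Qed.

(** Selfadjointness makes the quaternionic value of the form real, so the
    sign of its real part is all that positivity has to say. *)
Lemma psd_of_frob n (Z : 'M[H]_n) : selfadjoint Z ->
  (forall x : 'cV_n, 0 <= frob x (Z *m x)) -> psd Z.
Proof.
move=> Zsa Zge0; split=> // x; exists (frob x (Z *m x)) => //.
rewrite -qr_qform; apply: qconj_fix.
have {2}-> : qform Z x = conjtr (conjtr x *m Z *m x) 0 0.
  by rewrite !conjtrM conjtrK Zsa mulmxA.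
by rewrite [RHS]mxE [X in _ = qconj X]mxE.
Qed.

Lemma psd_frob_ge0 n (Z : 'M[H]_n) (x : 'cV[H]_n) :
  psd Z -> 0 <= frob x (Z *m x).
Proof. by move=> [_ /(_ x) [a a0]]; rewrite -qr_qform => ->. Qed.

End ConjugateTranspose.

(** * Positive definite matrices and their Cholesky factors *)

Section Cholesky.
Variable R : realType.
Local Notation H := (quaternion R).

Definition posdef n (Z : 'M[H]_n) : Prop :=
  selfadjoint Z /\ forall x : 'cV[H]_n, x != 0 -> 0 < frob x (Z *m x).

Lemma posdef_ul m n (M : 'M[H]_m) (N : 'M[H]_(m, n)) C (D : 'M[H]_n) :
  posdef (block_mx M N C D) -> posdef M.
Proof.
move=> [sa pos]; split.
  by move: sa; rewrite /selfadjoint conjtr_block => /eq_block_mx[].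
move=> x x0; have := pos (col_mx x 0).
rewrite mul_block_col !mulmx0 !addr0 frob_col frob0l addr0.
by apply; rewrite col_mx_eq0 (negPf x0).
Qed.

(** Completing the square: with [M = L L^*] and [N = L W] the form of the block
    matrix at [col_mx (- M^-1 N y) y] is that of the Schur complement at [y]. *)
Lemma posdef_schur m n (L L' : 'M[H]_m) (W : 'M[H]_(m, n)) (D : 'M[H]_n) :
    L' *m L = 1%:M ->
    posdef (block_mx (L *m conjtr L) (L *m W) (conjtr (L *m W)) D) ->
  posdef (D - conjtr W *m W).
Proof.
move=> L'L [sa pos]; split.
  move: sa; rewrite /selfadjoint conjtr_block => /eq_block_mx[_ _ _ Dsa].
  by rewrite raddfB /= conjtrM conjtrK Dsa.
move=> y y0; have := pos (col_mx (- (conjtr L' *m (W *m y))) y).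
have eW : conjtr L *m (conjtr L' *m (W *m y)) = W *m y.
  by rewrite mulmxA -conjtrM L'L conjtr1 mul1mx.
rewrite mul_block_col frob_col !mulmxN conjtrM.
rewrite -(mulmxA L (conjtr L)) -(mulmxA (conjtr W) (conjtr L)) eW.
rewrite !mulmxA addNr raddf0 add0r addrC -mulmxBl.
by apply; rewrite col_mx_eq0 (negPf y0) andbF.
Qed.

(** Split off the first row and column: the corner is a positive real, with a
    real square root, and the Schur complement is again positive definite. The
    inverse of the factor is built along the way. *)
Lemma cholesky n (Z : 'M[H]_n) : posdef Z ->
  exists L L' : 'M[H]_n, [/\ Z = L *m conjtr L, L' *m L = 1%:M & L *m L' = 1%:M].
Proof.
elim: n Z => [|n IHn] Z pZ.
  by exists 1%:M, 1%:M; split; apply/matrixP => - [].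
have : exists (M : 'M[H]_1) N (D : 'M[H]_n),
    Z = block_mx M N (conjtr N) D /\ posdef (block_mx M N (conjtr N) D).
  exists (ulsubmx (Z : 'M_(1 + n))), (ursubmx (Z : 'M_(1 + n))).
  exists (drsubmx (Z : 'M_(1 + n))).
  have e : Z = block_mx (ulsubmx (Z : 'M_(1 + n))) (ursubmx (Z : 'M_(1 + n)))
      (conjtr (ursubmx (Z : 'M_(1 + n)))) (drsubmx (Z : 'M_(1 + n))).
    case: pZ => /(congr1 (fun A : 'M[H]_(1 + n) => dlsubmx A)) sa _.
    suff -> : conjtr (ursubmx (Z : 'M_(1 + n))) = dlsubmx (Z : 'M_(1 + n)).
      by rewrite submxK.
    by rewrite -[in RHS]sa; apply/matrixP => i j; rewrite !mxE.
  by split; first exact: e; rewrite -e.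
move=> [M [N [D [-> {}pZ]]]].
have [Msa Mpos] := posdef_ul pZ.
have M00 : M 0 0 = qreal (qr (M 0 0)).
  by apply: qconj_fix; rewrite -{2}Msa !mxE.
pose a := qr (M 0 0); have a0 : 0 < a.
  have : (1%:M : 'cV[H]_1) != 0 by exact: oner_neq0.
  by move/Mpos; rewrite mulmx1 /frob conjtr1 mul1mx trace_mx11.
pose s := Num.sqrt a; have s0 : s != 0 by rewrite gt_eqF // sqrtr_gt0.
have ss : s * s = a by rewrite -expr2 sqr_sqrtr // ltW.
pose L1 : 'M[H]_1 := (qreal s)%:M; pose L1' : 'M[H]_1 := (qreal s^-1)%:M.
have LL : L1 *m conjtr L1 = M.
  by rewrite conjtr_scalar qconj_real -scalar_mxM -rmorphM /= ss -M00 -mx11_scalar.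
have LV : L1' *m L1 = 1%:M by rewrite -scalar_mxM -rmorphM /= mulVf // rmorph1.
have VL : L1 *m L1' = 1%:M by rewrite -scalar_mxM -rmorphM /= mulfV // rmorph1.
pose W := L1' *m N; have LW : L1 *m W = N by rewrite mulmxA VL mul1mx.
have /IHn[K [K' [KK KV VK]]] : posdef (D - conjtr W *m W).
  by apply: (posdef_schur LV); rewrite LL LW.
suff: exists L L' : 'M[H]_(1 + n), [/\ block_mx M N (conjtr N) D = L *m conjtr L,
  L' *m L = 1%:M & L *m L' = 1%:M] by [].
exists (block_mx L1 0 (conjtr W) K), (block_mx L1' 0 (- (K' *m conjtr W *m L1')) K').
split.
- rewrite conjtr_block conjtrK raddf0 mulmx_block !mul0mx !mulmx0 !addr0 -KK LL LW.
  by rewrite -conjtrM LW addrC subrK.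
- rewrite mulmx_block !mul0mx !mulmx0 !addr0 add0r KV LV mulNmx -!mulmxA LV mulmx1.
  by rewrite addNr -scalar_mx_block.
- rewrite mulmx_block !mul0mx !mulmx0 !addr0 add0r VK VL mulmxN -!mulmxA.
  by rewrite (mulmxA K) VK mul1mx subrr -scalar_mx_block.
Qed.
End Cholesky.

(** * Chains of vectors and the numerical radius *)

Section KeyInequality.
Variable R : realType.
Local Notation H := (quaternion R).

(** The bound [r(A) <= 1] in homogeneous form, free of suprema. *)
Definition numrad_le1 n (A : 'M[H]_n) : Prop :=
  forall x : 'cV[H]_n, qmod (qform A x) <= frob x x.

Lemma sum_superdiag (F : nat -> nat -> R) m :
  \sum_(j < m.+1) \sum_(l < m.+1 | l == j.+1 :> nat) F j l
  = \sum_(j < m) F j j.+1.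
Proof.
have out (l : 'I_m.+1) : (l == m.+1 :> nat) = false.
  by apply/negbTE; rewrite neq_ltn ltn_ord.
rewrite big_ord_recr /= [X in _ + X]big_pred0 // addr0.
apply: eq_bigr => j _; by rewrite (big_pred1 (lift ord0 j)).
Qed.

Lemma qconjX (w : H) k : qconj (w ^+ k) = qconj w ^+ k.
Proof. by elim: k => [|k IH]; rewrite ?expr0 ?qconj1 // exprS qconjM IH exprSr. Qed.

Lemma frob_trig_sum n m (Z : 'M[H]_n) (q : nat -> 'cV[H]_n) (w u : H)
    (y := \sum_(j < m) q j *m (w ^+ j)%:M) :
  frob y (Z *m y *m (u%:M : 'M_1))
  = \sum_(j < m) \sum_(l < m)
      qr ((conjtr (q j) *m Z *m q l) 0 0 * (w ^+ l * u * qconj w ^+ j)).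
Proof.
rewrite /y mulmx_sumr mulmx_suml frobC raddf_sum; apply: eq_bigr => j _ /=.
rewrite frobC raddf_sum; apply: eq_bigr => l _ /=.
rewrite /frob conjtrM conjtr_scalar qconjX -!mulmxA qr_trC !mulmxA.
rewrite trace_mx11 -!mulmxA -!scalar_mxM !mulmxA.
by rewrite [in LHS](mx11_scalar (_ *m _ *m q l)) -scalar_mxM mxE eqxx mulr1n !mulrA.
Qed.

(** The numerical radius of [A] bounds the form at [y = \sum_j q j * w ^+ j]
    for each unit [w]; averaging over [w] isolates the terms that couple
    consecutive vectors. *)
Lemma numrad_chain_vec n m (A : 'M[H]_n) (q : nat -> 'cV[H]_n) : numrad_le1 A ->
  \sum_(j < m) frob (q j) (A *m q j.+1) <= \sum_(j < m.+1) frob (q j) (q j).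
Proof.
move=> A1.
pose c (Z : 'M[H]_n) j l : H := (conjtr (q j) *m Z *m q l) 0 0.
have qr_c Z j l : qr (c Z j l) = frob (q j) (Z *m q l).
  by rewrite /c /frob trace_mx11 mulmxA.
(* The terms of [|y|^2] carry the tag [true], those of
   [- Re (y^* A y (conj w))] the tag [false]. *)
pose I := (bool * ('I_m.+1 * 'I_m.+1))%type.
pose coef (i : I) : H := if i.1 then c 1%:M i.2.1 i.2.2 else - c A i.2.1 i.2.2.
pose ea (i : I) : nat := i.2.2.
pose eb (i : I) : nat := if i.1 then (i.2.1 : nat) else i.2.1.+1.
have split_sum (P : pred I) (F : I -> R) : \sum_(i | P i) F i =
    \sum_j \sum_(l | P (true, (j, l))) F (true, (j, l)) +
    \sum_j \sum_(l | P (false, (j, l))) F (false, (j, l)).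
  transitivity (\sum_b \sum_j \sum_(l | P (b, (j, l))) F (b, (j, l))).
    under [RHS]eq_bigr => b _ do rewrite pair_big_dep.
    by rewrite pair_big_dep; apply: eq_big => [[b [j l]]|[b [j l]] _].
  by rewrite big_bool.
have := @trig_poly_mean_ge0 R m.+1 I xpredT coef ea eb.
rewrite !split_sum /=.
have -> : \sum_(j < m.+1) \sum_(l < m.+1 | ea (true, (j, l)) == eb (true, (j, l)))
    qr (coef (true, (j, l))) = \sum_(j < m.+1) frob (q j) (q j).
  apply: eq_bigr => j _; rewrite (big_pred1 j) ?qr_c ?mul1mx // => l.
have -> : \sum_(j < m.+1) \sum_(l < m.+1 | ea (false, (j, l)) == eb (false, (j, l)))
    qr (coef (false, (j, l))) = - \sum_(j < m) frob (q j) (A *m q j.+1).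
  rewrite -(sum_superdiag (fun j l => frob (q j) (A *m q l))) -sumrN.
  apply: eq_bigr => j _; rewrite -sumrN; apply: eq_bigr => l _.
  by rewrite /coef /= raddfN /= qr_c.
rewrite subr_ge0; apply.
  move=> [[] [j l]] _; rewrite /ea /eb /=; last by rewrite ltnW ltn_ord.
  by rewrite !(ltnW (ltn_ord _)).
move=> w w1; rewrite split_sum /=.
pose y := \sum_(j < m.+1) q j *m (w ^+ j)%:M.
rewrite [X in 0 <= X](_ : _ = frob y y - frob y (A *m y *m (qconj w)%:M)).
  rewrite subr_ge0; apply: le_trans (A1 y).
  rewrite /frob mulmxA trace_mx11 {1}mulmxA.
  rewrite [conjtr y *m A *m y]mx11_scalar -scalar_mxM mxE eqxx mulr1n.
  by apply: qr_mul_unit_le; rewrite qnormsq_conj.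
congr (_ + _).
  have := frob_trig_sum m.+1 1%:M q w 1.
  rewrite /= -/y mul1mx mulmx1 => ->.
  by apply: eq_bigr => j _; apply: eq_bigr => l _; rewrite mulr1.
rewrite frob_trig_sum -sumrN; apply: eq_bigr => j _.
rewrite -sumrN; apply: eq_bigr => l _.
by rewrite /coef /ea /eb /= exprS !mulNr raddfN !mulrA.
Qed.

Lemma numrad_chain n k m (A : 'M[H]_n) (V : nat -> 'M[H]_(n, k)) :
    numrad_le1 A ->
  \sum_(j < m) frob (V j) (A *m V j.+1) <= \sum_(j < m.+1) frob (V j) (V j).
Proof.
move=> A1; under eq_bigr => j _ do rewrite frob_cols.
under [leRHS]eq_bigr => j _ do rewrite frob_cols.
rewrite exchange_big [leRHS]exchange_big /=; apply: ler_sum => i _.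
under eq_bigr => j _ do rewrite [col i (_ *m _)]colE -mulmxA -colE.
exact: (@numrad_chain_vec n m A (fun j => col i (V j))).
Qed.

(** Telescoped, the first hypothesis reads [a 0 - a m <= b 0 - b m.+1]. Its sum
    over [m < M] and the second hypothesis at [M] cancel all the terms but
    [M * a 0 <= M * b 0 + b 0]. *)
Lemma le_of_telescoped_sums (a b : nat -> R) :
    (forall m, \sum_(j < m) (a j - a j.+1) <= \sum_(j < m.+1) (b j - b j.+1)) ->
    (forall m, \sum_(j < m) a j <= \sum_(j < m.+1) b j) ->
  a 0%N <= b 0%N.
Proof.
move=> diff_le sum_le.
have tel (h : nat -> R) k : \sum_(j < k) (h j - h j.+1) = h 0%N - h k.
  elim: k => [|k IHk]; first by rewrite big_ord0 subrr.
  by rewrite big_ord_recr /= IHk addrA subrK.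
have bound M : (a 0%N - b 0%N) *+ M <= b 0%N.
  have : \sum_(m < M) (a 0%N - a m) <= \sum_(m < M) (b 0%N - b m.+1).
    by apply: ler_sum => m _; have := diff_le m; rewrite !tel.
  have := sum_le M; rewrite big_ord_recl /=.
  rewrite !sumrB !sumr_const !card_ord mulrnBl; lra.
rewrite leNgt; apply/negP => lt_ba.
have ab0 : 0 < a 0%N - b 0%N by rewrite subr_gt0.
have := bound (Num.Def.archi_bound (b 0%N / (a 0%N - b 0%N))).
rewrite -mulr_natl -ler_pdivlMr // leNgt archi_boundP // divr_ge0 ?(ltW ab0) //.
by have := sum_le 0%N; rewrite big_ord0 big_ord1.
Qed.

(** A chain [x_(j+1) = P x_j + noise] with noise covariance [G G^*] has [X] as
    its stationary covariance. It decomposes into the chain [P ^ j L] of its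
    starting point and the chains [P ^ j G] of the noise injected at each
    step; [numrad_chain] bounds each of them. *)
Lemma numrad_stein n (A P X G L : 'M[H]_n) : numrad_le1 A ->
    X = L *m conjtr L -> X - P *m X *m conjtr P = G *m conjtr G ->
  qr (\tr (A *m P *m X)) <= qr (\tr X).
Proof.
move=> A1 XL XG.
(* [iter j step X] is the part of the covariance that was already present [j]
   steps earlier; [f] and [g] are the two sides of the chain bound in terms of
   covariances. *)
pose step (W : 'M[H]_n) := P *m W *m conjtr P.
pose f W := qr (\tr (A *m P *m W)); pose g (W : 'M[H]_n) := qr (\tr W).
have fB U V : f (U - V) = f U - f V by rewrite /f mulmxBr !raddfB.
have gB U V : g (U - V) = g U - g V by rewrite /g !raddfB.
have stepB U V : step (U - V) = step U - step V.
  by rewrite /step mulmxBr mulmxBl.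
have iterB j U V : iter j step (U - V) = iter j step U - iter j step V.
  by elim: j => [|j IHj]; rewrite ?iterS ?IHj ?stepB.
have chain (V : 'M[H]_n) m :
    \sum_(j < m) f (iter j step (V *m conjtr V)) <=
    \sum_(j < m.+1) g (iter j step (V *m conjtr V)).
  pose v j := iter j (mulmx P) V.
  have vS j : v j.+1 = P *m v j by [].
  have stepV j : iter j step (V *m conjtr V) = v j *m conjtr (v j).
    by elim: j => [|j IHj]; rewrite ?vS ?iterS // IHj /step conjtrM !mulmxA.
  have fV j : f (iter j step (V *m conjtr V)) = frob (v j) (A *m v j.+1).
    by rewrite stepV /f vS /frob (mulmxA (A *m P)) qr_trC !mulmxA.
  have gV j : g (iter j step (V *m conjtr V)) = frob (v j) (v j).
    by rewrite stepV /g qr_trC.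
  under eq_bigr => j _ do rewrite fV.
  under [leRHS]eq_bigr => j _ do rewrite gV.
  exact: numrad_chain.
have GD j : iter j step (G *m conjtr G) = iter j step X - iter j.+1 step X.
  by rewrite -XG iterB iterSr.
apply: (le_of_telescoped_sums (a := fun j => f (iter j step X))
          (b := fun j => g (iter j step X))) => m.
- have := chain G m; under eq_bigr => j _ do rewrite GD fB.
  by under [leRHS]eq_bigr => j _ do rewrite GD gB.
- by have := chain L m; rewrite -XL.
Qed.

End KeyInequality.

(** * Feasible block matrices bound the dual norm *)

Section Duality.
Variable R : realType.
Local Notation H := (quaternion R).

Lemma frob_block n (X Y : 'M[H]_n) (u v : 'cV[H]_n) :
  frob (col_mx u v) (block_mx X Y (conjtr Y) X *m col_mx u v)
  = frob u (X *m u) + 2 * frob u (Y *m v) + frob v (X *m v).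
Proof.
rewrite mul_block_col frob_col !frobDr [frob v (conjtr Y *m u)]frob_adj conjtrK.
by rewrite [frob (Y *m v) u]frobC mulr_natl mulr2n !addrA.
Qed.

Lemma psd_blockP n (X Y : 'M[H]_n) : selfadjoint X ->
  psd (block_mx X Y (conjtr Y) X) <-> forall u v : 'cV[H]_n,
    0 <= frob u (X *m u) + 2 * frob u (Y *m v) + frob v (X *m v).
Proof.
move=> Xsa; split=> [Z u v|pos]; first by rewrite -frob_block psd_frob_ge0.
apply: psd_of_frob => [|x].
  by rewrite /selfadjoint conjtr_block conjtrK Xsa.
by rewrite -[x]vsubmxK frob_block.
Qed.

(** The perturbation [X + e] makes the block matrix positive definite, so that
    [X] becomes invertible and the Schur complement has a Cholesky factor;
    [numrad_stein] then applies with [P = Y^* X^-1]. *)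
Lemma numrad_frob_le n (A X Y : 'M[H]_n) : numrad_le1 A ->
  psd (block_mx X Y (conjtr Y) X) -> frob A Y <= qr (\tr X).
Proof.
move=> A1 Zpsd.
suff bound e : 0 < e -> frob A Y <= qr (\tr X) + e * n%:R.
  apply/ler_addgt0Pr => e e0; have n1 : 0 < n%:R + 1 :> R by rewrite ltr_wpDl.
  apply: le_trans (bound (e / (n%:R + 1)) _) _; first by rewrite divr_gt0.
  by rewrite lerD2l -mulrAC ler_pdivrMr // ler_pM2l // lerDl.
move=> e0; pose X' := X + (qreal e)%:M.
have Xsa : selfadjoint X.
  by case: Zpsd; rewrite /selfadjoint conjtr_block => /eq_block_mx[].
have Z'pos : posdef (block_mx X' Y (conjtr Y) X').
  split.
    by rewrite /selfadjoint conjtr_block conjtrK raddfD /= conjtr_scalar qconj_real Xsa.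
  move=> x; rewrite -[x]vsubmxK; set u := usubmx x; set v := dsubmx x => uv0.
  rewrite frob_block !mulmxDl !frobDr !mul_scalar_mx !frobZr.
  have := (psd_blockP Y Xsa).1 Zpsd u v.
  have : 0 < e * (frob u u + frob v v) by rewrite mulr_gt0 // -frob_col frob_gt0.
  move: (frob u (X *m u)) (frob u (Y *m v)) (frob v (X *m v)) (frob u u) (frob v v).
  by clear=> *; lra.
have [L [L' [XL L'L LL']]] := cholesky (posdef_ul Z'pos).
pose W := L' *m Y; have LW : L *m W = Y by rewrite mulmxA LL' mul1mx.
have : posdef (X' - conjtr W *m W) by apply: (posdef_schur L'L); rewrite -XL LW.
move=> /cholesky[G [_ [XG _ _]]].
pose P := conjtr W *m L'.
have PX : P *m X' = conjtr Y.
  by rewrite /P XL -mulmxA (mulmxA L') L'L mul1mx -LW conjtrM.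
have PXP : P *m X' *m conjtr P = conjtr W *m W.
  rewrite PX /P conjtrM conjtrK -LW conjtrM mulmxA -(mulmxA (conjtr W)).
  by rewrite -conjtrM L'L conjtr1 mulmx1.
rewrite -PXP in XG; have := numrad_stein A1 XL XG.
rewrite -mulmxA PX qr_trC -/(frob Y A)frobC.
by rewrite !raddfD /= mxtrace_scalar raddfMn /= mulr_natr.
Qed.

Lemma conjtr_mul_vec n (x : 'cV[H]_n) : conjtr x *m x = (qreal (frob x x))%:M.
Proof.
rewrite [LHS]mx11_scalar /frob trace_mx11; congr (_%:M); apply: qconj_fix.
have e : conjtr (conjtr x *m x) = conjtr x *m x by rewrite conjtrM conjtrK.
by rewrite -[in RHS]e [RHS]mxE [X in _ = qconj X]mxE.
Qed.

Lemma unit_vecP n (x : 'cV[H]_n) : conjtr x *m x = 1%:M <-> frob x x = 1.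
Proof.
rewrite conjtr_mul_vec; split=> [/matrixP/(_ 0 0)|->]; last by rewrite rmorph1.
by rewrite !mxE => /(congr1 (@qr R)).
Qed.

Lemma qform_scale n (A : 'M[H]_n) (x : 'cV[H]_n) (s : H) :
  qform A (x *m s%:M) = qconj s * qform A x * s.
Proof.
rewrite /qform conjtrM conjtr_scalar -!mulmxA (mulmxA A) (mulmxA (conjtr x)).
rewrite mulmxA (mulmxA (conjtr x)) [conjtr x *m A *m x]mx11_scalar -!scalar_mxM.
by rewrite !mxE eqxx !mulr1n.
Qed.

Lemma qmod_qform_scaler n (A : 'M[H]_n) (x : 'cV[H]_n) (t : R) : 0 <= t ->
  qmod (qform (qreal t *: A) x) = t * qmod (qform A x).
Proof.
move=> t0; rewrite -[t in RHS]qmod_real // -qmodM /qform -mulmx_real.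
rewrite -!mulmxA mul_scalar_mx -mulmx_real !mulmxA mulmx_real mxE; exact: erefl.
Qed.

Lemma qconj_qform n (A : 'M[H]_n) (x : 'cV[H]_n) :
  qconj (qform A x) = qform (conjtr A) x.
Proof.
have e : conjtr x *m conjtr A *m x = conjtr (conjtr x *m A *m x).
  by rewrite !conjtrM conjtrK mulmxA.
by rewrite /qform e [RHS]mxE [X in _ = qconj X]mxE.
Qed.

(** Without this bound the supremum defining the numerical radius could be the
    default value 0 of an unbounded set. *)
Lemma qform_bounded n (A : 'M[H]_n) (x : 'cV[H]_n) : frob x x = 1 ->
  qmod (qform A x) <= \sum_i \sum_j (1 + qnormsq (A i j)) / 2.
Proof.
move=> x1; have [d d1 <-] := qmod_attained (qform A x).
have x_le1 i : qnormsq (x i 0) <= 1.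
  rewrite -x1 frob_norm big_ord1 (bigD1 i) //= lerDl.
  by apply: sumr_ge0 => j _; exact: qnormsq_ge0.
rewrite /qform -mulmxA mxE mulr_suml raddf_sum /=; apply: ler_sum => i _.
rewrite !mxE mulr_sumr mulr_suml raddf_sum /=; apply: ler_sum => j _.
rewrite -!mulrA; apply: le_trans (qr_conj_mul_le _ _) _.
rewrite !qnormsqM d1 mulr1; have := x_le1 i; have := x_le1 j.
have := qnormsq_ge0 (A i j); nra.
Qed.

Lemma exists_unit_vec n : (0 < n)%N -> exists x : 'cV[H]_n, frob x x = 1.
Proof.
move=> n0; exists (delta_mx (Ordinal n0) 0).
rewrite frob_norm big_ord1 (bigD1 (Ordinal n0)) //= big1 ?addr0 => [|i /negPf ne].
  by rewrite mxE !eqxx qnormsq1.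
by rewrite mxE ne /= mulr0n; apply/eqP; rewrite qnormsq_eq0.
Qed.

Lemma numerical_radius_le1 n (A : 'M[H]_n) : (0 < n)%N ->
  numerical_radius A <= 1 <->
  forall x : 'cV[H]_n, frob x x = 1 -> qmod (qform A x) <= 1.
Proof.
move=> n0; have [e e1] := exists_unit_vec n0.
rewrite /numerical_radius; set S := (X in sup X).
have ubS : has_ubound S.
  exists (\sum_i \sum_j (1 + qnormsq (A i j)) / 2) => _ [x /unit_vecP x1 <-].
  exact: qform_bounded.
split=> [rA x x1|A1].
  by apply: le_trans rA; apply: ub_le_sup => //; exists x => //; apply/unit_vecP.
apply: ge_sup; first by exists (qmod (qform A e)); exists e => //; apply/unit_vecP.
by move=> _ [x /unit_vecP x1 <-]; exact: A1.
Qed.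

Lemma numrad_le1_unit n (A : 'M[H]_n) :
    (forall x : 'cV[H]_n, frob x x = 1 -> qmod (qform A x) <= 1) ->
  numrad_le1 A.
Proof.
move=> A1 x.
have [->|x0] := eqVneq x 0.
  by rewrite raddf0 /qform mulmx0 mxE /qmod !expr0n !addr0 sqrtr0.
have N0 := frob_gt0 x0; pose s := Num.sqrt (frob x x).
have s0 : 0 < s by rewrite sqrtr_gt0.
have s2 : s ^+ 2 = frob x x by rewrite sqr_sqrtr // ltW.
pose y := x *m (qreal s^-1)%:M.
have y1 : frob y y = 1.
  by rewrite /y mulmx_real frobZl frobZr -s2; field; rewrite gt_eqF.
have := A1 y y1.
have s1 : 0 <= s^-1 by rewrite invr_ge0 ltW.
rewrite qform_scale qconj_real !qmodM !qmod_real // mulrC mulrA -invfM -expr2 s2.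
by rewrite mulrC ler_pdivrMr // mul1r.
Qed.

(** The form is [|u|^2 + |Y^* u + v|^2 + |Y^* v|^2]. After scaling, every [Y]
    is a multiple of a feasible corner, which bounds its dual norm. *)
Lemma gram_psd n (Y : 'M[H]_n) (X := 1%:M + Y *m conjtr Y) :
  selfadjoint X /\ psd (block_mx X Y (conjtr Y) X).
Proof.
have Xsa : selfadjoint X by rewrite /selfadjoint raddfD /= conjtr1 conjtrM conjtrK.
split=> //; apply/(psd_blockP _ Xsa) => u v.
rewrite /X !mulmxDl !mul1mx !frobDr -!mulmxA !(frob_adj Y).
have := frob_ge0 (conjtr Y *m u + v); have := frob_ge0 u.
have := frob_ge0 (conjtr Y *m v).
by rewrite !frobDl !frobDr [frob v (conjtr Y *m u)]frobC; lra.
Qed.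

(** The form is [|x^* u + d x^* v|^2]. *)
Lemma rank_one_psd n (x : 'cV[H]_n) (d : H) (X := x *m conjtr x) :
  qnormsq d = 1 ->
  selfadjoint X /\ psd (block_mx X (x *m d%:M *m conjtr x)
                                 (conjtr (x *m d%:M *m conjtr x)) X).
Proof.
move=> d1; have Xsa : selfadjoint X by rewrite /selfadjoint conjtrM conjtrK.
split=> //; apply/(psd_blockP _ Xsa) => u v.
rewrite /X -!mulmxA; set a := conjtr x *m u; set b := conjtr x *m v.
rewrite !(frob_adj x) -/a -/b.
have := frob_ge0 (a + d%:M *m b); rewrite !frobDl !frobDr.
rewrite [frob (_ *m b) a]frobC [frob (_ *m b) (_ *m b)]frob_mull conjtr_scalar.
by rewrite mulmxA -scalar_mxM qconj_mul d1 rmorph1 mul1mx; lra.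
Qed.

End Duality.

(** * Nearest points in intersections of half-spaces *)

Section Separation.
Local Open Scope classical_set_scope.
Local Open Scope ring_scope.
Variable R : realType.
Local Notation H := (quaternion R).
Local Notation coords N := 'rV[R]_#|{: 'I_N * 'I_N * 'I_4}|.

(** A basis of the matrices as a real vector space, orthonormal for [frob]. *)
Definition mx_unit N (t : 'I_N * 'I_N * 'I_4) : 'M[H]_N :=
  basic_unit R t.2 *: delta_mx t.1.1 t.1.2.

Lemma frob_mx_unit N (t : 'I_N * 'I_N * 'I_4) (Z : 'M[H]_N) :
  frob (mx_unit t) Z = qr (qconj (basic_unit R t.2) * Z t.1.1 t.1.2).
Proof.
case: t => [[a b] k]; rewrite frobE (bigD1 b) //= (bigD1 a) //=.
rewrite big1 ?addr0 => [|i /negPf ia]; last first.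
  by rewrite !mxE ia mulr0 raddf0 mul0r.
rewrite big1 ?addr0 => [|j /negPf jb]; last first.
  by rewrite big1 // => i _; rewrite !mxE jb andbF mulr0 raddf0 mul0r.
by rewrite !mxE !eqxx mulr1.
Qed.

Lemma mx_expand N (Z : 'M[H]_N) :
  Z = \sum_t qreal (frob (mx_unit t) Z) *: mx_unit t.
Proof.
pose term t := qreal (frob (mx_unit t) Z) *: mx_unit t.
rewrite -(pair_bigA _ (fun p k => term (p, k))) /=.
rewrite -(pair_bigA _ (fun i j => \sum_k term (i, j, k))) /=.
rewrite {1}[Z]matrix_sum_delta; apply: eq_bigr => i _; apply: eq_bigr => j _.
rewrite {1}[Z i j]quat_expand scaler_suml; apply: eq_bigr => k _.
by rewrite /term frob_mx_unit scalerA.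
Qed.

Section Coordinates.
Variable N : nat.
Local Notation I := ('I_N * 'I_N * 'I_4)%type.

Definition mx_of_coords (v : coords N) : 'M[H]_N :=
  \sum_t qreal (v ord0 (enum_rank t)) *: mx_unit t.

Definition coords_of_mx (Z : 'M[H]_N) : coords N :=
  \row_i frob (mx_unit (enum_val i)) Z.

Lemma coords_of_mxK Z : mx_of_coords (coords_of_mx Z) = Z.
Proof.
rewrite [RHS]mx_expand; apply: eq_bigr => t _.
by rewrite mxE enum_rankK.
Qed.

Lemma continuous_sumr (T : topologicalType) (J : Type) (r : seq J)
    (F : J -> T -> R) : (forall i, continuous (F i)) ->
  continuous (fun x => \sum_(i <- r) F i x).
Proof.
move=> cF; apply: continuous_big => //; exact: add_continuous.
Qed.

Lemma continuous_coord (t : I) :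
  continuous (fun v : coords N => v ord0 (enum_rank t) : R).
Proof. exact: coord_continuous. Qed.

Lemma continuous_scaled_coord (t : I) (f : coords N -> R) : continuous f ->
  continuous (fun v : coords N => v ord0 (enum_rank t) * f v).
Proof.
by move=> cf v; apply: continuousM; [exact: continuous_coord|exact: cf].
Qed.

Lemma frob_mx_of_coords m n (g : {linear 'M[H]_N -> 'M[H]_(m, n)}) C (v : coords N) :
  frob C (g (mx_of_coords v)) =
  \sum_t v ord0 (enum_rank t) * frob C (g (mx_unit t)).
Proof.
rewrite !raddf_sum; apply: eq_bigr => t _ /=.
by rewrite linearZ frobZr.
Qed.

Lemma continuous_frob m n (g : {linear 'M[H]_N -> 'M[H]_(m, n)}) C :
  continuous (fun v : coords N => frob C (g (mx_of_coords v))).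
Proof.
rewrite (_ : (fun v => _) = (fun v : coords N =>
    \sum_t v ord0 (enum_rank t) * frob C (g (mx_unit t)))); last first.
  by apply/funext => v; rewrite frob_mx_of_coords.
apply: continuous_sumr => t; apply: continuous_scaled_coord.
exact: cst_continuous.
Qed.

Lemma continuous_dist m n (g : {linear 'M[H]_N -> 'M[H]_(m, n)}) C :
  continuous (fun v : coords N =>
    frob (C - g (mx_of_coords v)) (C - g (mx_of_coords v))).
Proof.
rewrite (_ : (fun v => _) = (fun v : coords N => frob C C +
    \sum_t v ord0 (enum_rank t) * frob (g (mx_of_coords v)) (g (mx_unit t))
    - 2 * frob C (g (mx_of_coords v)))); last first.
  apply/funext => v; rewrite -frob_mx_of_coords raddfB /=.
  rewrite !frobBl !raddfB /= [frob (g _) C]frobC; ring.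
have c1 : continuous (fun v : coords N =>
    \sum_t v ord0 (enum_rank t) * frob (g (mx_of_coords v)) (g (mx_unit t))).
  apply: continuous_sumr => t; apply: continuous_scaled_coord.
  under eq_fun do rewrite frobC.
  exact: continuous_frob.
have c2 := @continuous_frob _ _ g C.
have c2' : continuous (fun v : coords N => 2 * frob C (g (mx_of_coords v))).
  move=> v; apply: (@continuousM _ _ (fun=> 2)); last exact: c2.
  exact: cst_continuous.
move=> v; apply: (cvgB _ (c2' v)); apply: (cvgD _ (c1 v)); exact: cvg_cst.
Qed.

End Coordinates.

(** The set [S] is compact, so some [Z0] in it minimises the distance from
    [C] to [g Z0]; moving from [Z0] towards [Z1] inside the convex set [S]
    cannot decrease that distance, which gives the inequality. The second
    hypothesis says that [S] is an intersection of half-spaces, and provides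
    both closedness and convexity. *)
Lemma nearest_point N m n (g : {linear 'M[H]_N -> 'M[H]_(m, n)})
    (S : set 'M[H]_N) (B : R) (C : 'M[H]_(m, n)) :
    (exists Z, S Z) ->
    (forall Z, (forall D c, (forall Z', S Z' -> c <= frob D Z') -> c <= frob D Z) ->
      S Z) ->
    (forall Z t, S Z -> `|frob (mx_unit t) Z| <= B) ->
  exists2 Z0, S Z0 & forall Z1, S Z1 -> frob (C - g Z0) (g Z1 - g Z0) <= 0.
Proof.
move=> [Zs SZs] halfS bndS.
pose K : set (coords N) := [set v | S (mx_of_coords v)
   /\ forall i, v ord0 i \in `[- B, B]].
have cK : compact K.
  have cbox := @rV_compact R _ (fun _ => `[- B, B]%classic)
    (fun _ => @segment_compact R _ _).
  pose F := [set p : 'M[H]_N * R | forall Z, S Z -> p.2 <= frob p.1 Z].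
  pose half (p : 'M[H]_N * R) := [set v : coords N | p.2 <= frob p.1 (mx_of_coords v)].
  have cF : closed (\bigcap_(p in F) half p).
    apply: closed_bigI => p _.
    apply: (preimage_closed (D := [set a : R | p.2 <= a])); last exact: closed_ge.
    by move=> v _; exact: (@continuous_frob N N N idfun p.1 v).
  have := compact_closedI (cbox _) cF; congr compact.
  apply/seteqP; split=> v /= [h1 h2]; split=> //.
    by apply: halfS => D c Dc; exact: (h2 (D, c)).
  by move=> p Fp; exact: Fp.
have [v0 /set_mem[Sv0 _] minv0] : exists2 c, c \in K & forall v : coords N,
   v \in K -> frob (C - g (mx_of_coords c)) (C - g (mx_of_coords c)) <=
   frob (C - g (mx_of_coords v)) (C - g (mx_of_coords v)).
  apply: EVT_min_rV cK _.
    exists (coords_of_mx Zs); split; first by rewrite coords_of_mxK.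
    by move=> i; rewrite mxE in_itv /= -ler_norml bndS.
  by apply: continuous_subspaceT; exact: continuous_dist.
exists (mx_of_coords v0) => // Z1 SZ1.
set Z0 := mx_of_coords v0 in Sv0 minv0 *.
set U := C - g Z0 in minv0 *; set V := g Z1 - g Z0.
have minS Z : S Z -> frob U U <= frob (C - g Z) (C - g Z).
  move=> SZ; have := minv0 (coords_of_mx Z); rewrite coords_of_mxK; apply.
  apply/mem_set; split; first by rewrite coords_of_mxK.
  by move=> i; rewrite mxE in_itv /= -ler_norml bndS.
have quad t : 0 <= t <= 1 -> 2 * t * frob U V <= t ^+ 2 * frob V V.
  move=> /andP[t0 t1].
  have : S (Z0 + qreal t *: (Z1 - Z0)).
    apply: halfS => D c Dc; have := Dc _ Sv0; have := Dc _ SZ1.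
    rewrite raddfD /= frobZr raddfB /=; nra.
  move/minS; rewrite (raddfD g) /= linearZ (raddfB g) /= -/V.
  have -> : C - (g Z0 + qreal t *: V) = U - qreal t *: V by rewrite opprD addrA.
  by rewrite frob_sub_scale; lra.
rewrite leNgt; apply/negP => UV0.
have VV0 : 0 < frob V V by have := quad 1 _; rewrite ler01 lexx => /(_ isT); lra.
have UV1 : frob U V / frob V V <= 1.
  rewrite ler_pdivrMr // mul1r; have := quad 1 _.
  by rewrite ler01 lexx => /(_ isT); lra.
(* The minimiser of the quadratic along the line of direction [V]. *)
have := quad (frob U V / frob V V); rewrite UV1 andbT.
rewrite divr_ge0 ?(ltW UV0) ?(ltW VV0) // => /(_ isT).
rewrite [X in X <= _](_ : _ = 2 * (frob U V ^+ 2 / frob V V)); last by ring.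
rewrite [leRHS](_ : _ = frob U V ^+ 2 / frob V V); last by field; rewrite gt_eqF.
by have : 0 < frob U V ^+ 2 / frob V V; [rewrite divr_gt0 ?exprn_gt0 | lra].
Qed.

End Separation.

(** * Feasible corners exhaust the dual unit ball *)

Section FeasibleSet.
Variable R : realType.
Local Notation H := (quaternion R).

Lemma selfadjoint_tr n (X : 'M[H]_n) : selfadjoint X ->
  \tr X = qreal (qr (\tr X)).
Proof.
move=> Xsa; apply: qconj_fix; rewrite -{2}Xsa /mxtrace raddf_sum.
by apply: eq_bigr => i _; rewrite !mxE.
Qed.

Lemma frob_blocks n (A B C D A' B' C' D' : 'M[H]_n) :
  frob (block_mx A B C D) (block_mx A' B' C' D')
  = frob A A' + frob B B' + frob C C' + frob D D'.
Proof.
rewrite /frob conjtr_block mulmx_block mxtrace_block !raddfD /=.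
by rewrite -!addrA; congr (_ + _); rewrite addrCA.
Qed.

Lemma frob_delta n (i : 'I_n) (v : 'cV[H]_n) : frob (delta_mx i 0) v = qr (v i 0).
Proof.
rewrite frobE big_ord1 (bigD1 i) //= big1 => [|k /negPf ne].
  by rewrite mxE !eqxx addr0 qconj1 mul1r.
by rewrite mxE ne raddf0 mul0r.
Qed.

Lemma psd_diag_le_tr n (Z : 'M[H]_n) i : psd Z -> qr (Z i i) <= qr (\tr Z).
Proof.
move=> Zpsd; rewrite /mxtrace raddf_sum /= (bigD1 i) //= lerDl.
apply: sumr_ge0 => k _.
by have := psd_frob_ge0 (delta_mx k 0) Zpsd; rewrite -colE frob_delta mxE.
Qed.

(** The off-diagonal entries of a positive semidefinite matrix are dominated
    by the diagonal ones, as the form at [a + b] and [a - b] shows. *)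
Lemma psd_mx_unit_le n (Z : 'M[H]_n) t : psd Z ->
  `|frob (mx_unit R t) Z| <= qr (\tr Z).
Proof.
case: t => [[i j] k] Zpsd; rewrite frob_mx_unit /=.
set u := basic_unit R k; have u1 : qnormsq u = 1 by exact: basic_unit_norm.
pose a : 'cV[H]_n := delta_mx i 0; pose b : 'cV[H]_n := delta_mx j 0 *m (qconj u)%:M.
have aa : frob a (Z *m a) = qr (Z i i) by rewrite -colE frob_delta mxE.
have ab : frob a (Z *m b) = qr (qconj u * Z i j).
  rewrite mulmxA -colE frob_delta mxE big_ord1 !mxE eqxx mulr1n; exact: qrC.
have bb : frob b (Z *m b) = qr (Z j j).
  rewrite {1}/b frob_mulr conjtr_scalar qconjK /b -!mulmxA -scalar_mxM qconj_mul u1.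
  by rewrite rmorph1 mulmx1 -colE frob_delta mxE.
have ba : frob b (Z *m a) = frob a (Z *m b).
  by rewrite frob_adj Zpsd.1 frobC.
have := psd_frob_ge0 (a + b) Zpsd; have := psd_frob_ge0 (a - b) Zpsd.
rewrite mulmxBr mulmxDr !raddfB !raddfD /= !frobBl !frobDl aa bb ba ab.
have := psd_diag_le_tr i Zpsd; have := psd_diag_le_tr j Zpsd.
move: (qr (Z i i)) (qr (Z j j)) (qr (qconj u * Z i j)) (qr (\tr Z)); clear.
by move=> p q r s *; rewrite ler_norml; apply/andP; split; lra.
Qed.

(** The block matrices are collected whole, rather than their corners, so that
    every condition is a family of linear inequalities on a single matrix. *)
Definition feasible n (Z : 'M[H]_(n + n)) : Prop := exists X V : 'M[H]_n,
  [/\ Z = block_mx X V (conjtr V) X, selfadjoint X, \tr X = 1 & psd Z].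

Lemma feasible_tr n (Z : 'M[H]_(n + n)) : feasible Z -> qr (\tr Z) = 2.
Proof.
by move=> [X [V [-> _ X1 _]]]; rewrite mxtrace_block X1.
Qed.

(** Each defining condition is a family of real-linear inequalities; the
    equalities are tested by pairing the difference of their sides with
    itself. *)
Lemma feasible_halfspaces n (Z : 'M[H]_(n + n)) :
    (forall D c, (forall Z', feasible Z' -> c <= frob D Z') -> c <= frob D Z) ->
  feasible Z.
Proof.
move=> half.
have eq_half D c : (forall Z', feasible Z' -> frob D Z' = c) -> frob D Z = c.
  move=> Dc; apply/eqP; rewrite eq_le; apply/andP; split; last first.
    by apply: half => Z' /Dc ->.
  by rewrite -lerN2 -frobNl; apply: half => Z' /Dc DZ'; rewrite frobNl DZ'.
have Zsa : conjtr Z = Z.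
  apply/eqP; rewrite -subr_eq0; apply/eqP/frob_eq0; set W := conjtr Z - Z.
  have adj Z' : frob W (conjtr Z' - Z') = frob (conjtr W - W) Z'.
    by rewrite raddfB frobBl /= -[frob _ (conjtr Z')]frob_conjtr conjtrK.
  rewrite {2}/W adj; apply: eq_half => Z' [X [V [_ _ _ [Z'sa _]]]].
  by rewrite -adj Z'sa subrr raddf0.
have Zblock : ulsubmx Z = drsubmx Z.
  apply/eqP; rewrite -subr_eq0; apply/eqP/frob_eq0; set W := _ - _.
  have blk Z' : frob W (ulsubmx Z' - drsubmx Z') = frob (block_mx W 0 0 (- W)) Z'.
    rewrite -[in RHS](submxK Z') frob_blocks !frob0l !addr0.
    by rewrite frobNl raddfB.
  rewrite {2}/W blk; apply: eq_half => Z' [X [V [-> _ _ _]]].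
  by rewrite -blk block_mxKul block_mxKdr subrr raddf0.
have ZE : Z = block_mx (ulsubmx Z) (ursubmx Z) (conjtr (ursubmx Z)) (ulsubmx Z).
  have dlE : conjtr (ursubmx Z) = dlsubmx Z.
    by rewrite -[in RHS]Zsa; apply/matrixP => i j; rewrite !mxE.
  by rewrite {2}Zblock dlE submxK.
have Xsa : selfadjoint (ulsubmx Z).
  by move: Zsa; rewrite ZE conjtr_block !block_mxKul => /eq_block_mx[].
exists (ulsubmx Z), (ursubmx Z); split=> //.
  rewrite selfadjoint_tr //.
  have tr1 (Z' : 'M[H]_(n + n)) :
      qr (\tr (ulsubmx Z')) = frob (block_mx 1%:M 0 0 0) Z'.
    rewrite -[in RHS](submxK Z') frob_blocks !frob0l !addr0.
    by rewrite /frob conjtr1 mul1mx.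
  rewrite tr1 (eq_half _ 1) // => Z' [X [V [-> _ X1 _]]].
  by rewrite -tr1 block_mxKul X1.
apply: psd_of_frob => // x.
have form Z' : frob x (Z' *m x) = frob (x *m conjtr x) Z'.
  by rewrite frob_mulr conjtrK.
by rewrite form; apply: half => Z' [X [V [_ _ _ Z'psd]]]; rewrite -form psd_frob_ge0.
Qed.

Lemma feasible_rank_one n (x : 'cV[H]_n) (d : H) : frob x x = 1 -> qnormsq d = 1 ->
  exists2 Z, feasible Z & ursubmx Z = x *m d%:M *m conjtr x.
Proof.
move=> x1 d1; have [Xsa Zpsd] := rank_one_psd x d1.
pose X := x *m conjtr x; pose V := x *m d%:M *m conjtr x.
exists (block_mx X V (conjtr V) X); last by rewrite block_mxKur.
exists X, V; split=> //.
by rewrite selfadjoint_tr // qr_trC -/(frob x x) x1 rmorph1.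
Qed.

(** Otherwise the nearest feasible corner [P] gives a separating matrix
    [A = Y - P]. Its numerical radius is at most [frob A P], because the
    matrices [x d x^*] are feasible corners, while [frob A Y] is larger. *)
Lemma dual_certificate n (Y : 'M[H]_n) : (0 < n)%N ->
    (forall A, (forall x : 'cV[H]_n, frob x x = 1 -> qmod (qform A x) <= 1) ->
      frob A Y <= 1) ->
  exists2 Z, feasible Z & ursubmx Z = Y.
Proof.
move=> n0 dualY; have [e e1] := exists_unit_vec R n0.
have [Ze Ze_feas _] := feasible_rank_one e1 (qnormsq1 R).
have bnd (Z : 'M[H]_(n + n)) t : feasible Z -> `|frob (mx_unit R t) Z| <= 2.
  move=> Zf; rewrite -(feasible_tr Zf).
  by case: Zf => X [V [_ _ _]]; exact: psd_mx_unit_le.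
have [Z0 Z0_feas near] : exists2 Z0, feasible Z0 & forall Z1, feasible Z1 ->
    frob (Y - ursubmx Z0) (ursubmx Z1 - ursubmx Z0) <= 0.
  apply: (@nearest_point R (n + n) n n (rsubmx \o usubmx) (@feasible n) 2 Y _ _ bnd).
    by exists Ze.
  exact: feasible_halfspaces.
exists Z0 => //; apply/eqP; rewrite eq_sym -subr_eq0.
move: near; set A := Y - ursubmx Z0 => near; apply: contraT => A0.
pose c := frob A (ursubmx Z0).
have AY : c < frob A Y by rewrite -subr_gt0 /c -raddfB frob_gt0.
have rA x : frob x x = 1 -> qmod (qform A x) <= c.
  move=> x1; rewrite -qmod_conj; have [d d1 <-] := qmod_attained (qconj (qform A x)).
  have [Z1 /near + Z1E] := feasible_rank_one x1 d1.
  rewrite raddfB /= subr_le0 Z1E; congr (_ <= _).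
  rewrite /frob !mulmxA qr_trC !mulmxA qconj_qform trace_mx11.
  by rewrite [_ *m _ *m x]mx11_scalar -scalar_mxM mxE eqxx mulr1n.
have c0 : 0 <= c by apply: le_trans (rA e e1); exact: qmod_ge0.
(* Scaling by the inverse of the midpoint of [c] and [frob A Y] brings the
   numerical radius below 1 and keeps the pairing with [Y] above 1; the number
   [c] itself may be 0. *)
pose t := 2 / (c + frob A Y).
have t0 : 0 < t by rewrite divr_gt0 // ltr_wpDl // (le_lt_trans c0).
have := dualY (qreal t *: A); rewrite frobZl.
have tA x : frob x x = 1 -> qmod (qform (qreal t *: A) x) <= 1.
  move=> /rA xc; rewrite qmod_qform_scaler ?(ltW t0) //.
  by rewrite /t mulrAC ler_pdivrMr ?mul1r; lra.
by move/(_ tA); rewrite /t mulrAC ler_pdivrMr ?mul1r; lra.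
Qed.

End FeasibleSet.

Theorem theorem5p2 (R : realType) (n : nat) (hn : (0 < n)%N)
    (Y : 'M[quaternion R]_n) :
  dual_numerical_radius Y <= 1 <->
  exists X : 'M[quaternion R]_n,
    [/\ selfadjoint X, \tr X = 1 & psd (block_mx X Y (conjtr Y) X)].
Proof.
rewrite /dual_numerical_radius; set S := (X in sup X).
have S_numrad (A : 'M[quaternion R]_n) : numerical_radius A <= 1 -> numrad_le1 A.
  by move/(numerical_radius_le1 A hn); exact: numrad_le1_unit.
have ubS X : psd (block_mx X Y (conjtr Y) X) -> ubound S (qr (\tr X)).
  by move=> Xpsd _ [A /S_numrad A1 <-]; exact: numrad_frob_le.
split=> [Y1|[X [_ X1 Zpsd]]]; last first.
  apply: ge_sup; last by rewrite -[1]/(qr 1) -X1; exact: ubS.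
  exists (qr (\tr (conjtr 0 *m Y))); exists 0 => //=.
  apply/(numerical_radius_le1 _ hn) => x _.
  by rewrite /qform mulmx0 mul0mx mxE /qmod !expr0n !addr0 sqrtr0.
have [Z [X [V [-> Xsa X1 Zpsd]]]] : exists2 Z, feasible Z & ursubmx Z = Y.
  apply: (dual_certificate hn) => A A1; apply: le_trans Y1.
  apply: ub_le_sup; last by exists A => //; apply/(numerical_radius_le1 _ hn).
  by exists (qr (\tr (1%:M + Y *m conjtr Y))); apply: ubS; case: (gram_psd Y).
by rewrite block_mxKur => <-; exists X.
Qed.
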